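(* Let $p\ge3$ be an integer and $\Theta=(0,\infty)\times\mathbb{R}$. Then $\mathfrak{R}_p=(\overline{\mathfrak{C}_p})^c$, where $\overline{S}$ denotes the closure of a set $S\subseteq\Theta$ with respect to the Euclidean topology and the complement is taken in $\Theta$.
   Context: For $(\beta,h)\in\Theta$, $H_{\beta,h,p}:[-1,1]\to\mathbb{R}$ is $H_{\beta,h,p}(x)=\beta x^p+hx-I(x)$, where $I(x)=\frac12\{(1+x)\log(1+x)+(1-x)\log(1-x)\}$. A stationary point is a zero of $H'_{\beta,h,p}$. $\mathfrak{R}_p$ is the set of all $(\beta,h)\in\Theta$ such that $H_{\beta,h,p}$ has a local maximizer $m_*\in(-1,1)$ with $H''_{\beta,h,p}(m_* )<0$, and has no other stationary point. $\mathfrak{C}_p$ is the set of all $(\beta,h)\in\Theta$ such that $H_{\beta,h,p}$ has more than one local maximizer. *)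

(* Defs.v *)
From HB Require Import structures.
From mathcomp Require Import all_boot all_order all_algebra.
From mathcomp Require Import all_classical all_reals all_analysis.

Set Implicit Arguments.
Unset Strict Implicit.
Unset Printing Implicit Defensive.

Import Order.TTheory GRing.Theory Num.Theory.
Import numFieldNormedType.Exports.

Local Open Scope ring_scope.
Local Open Scope classical_set_scope.

Definition Theta (R : realType) : set (R * R)%type := [set bh | 0 < bh.1].
Arguments Theta : clear implicits.

(* Only the values on [-1, 1] matter. The convention 0 log 0 = 0 at the
   endpoints holds because of the factor 0 in front of the logarithm. *)
Definition rate_I (R : realType) (x : R) : R :=
  2^-1 * ((1 + x) * ln (1 + x) + (1 - x) * ln (1 - x)).

Definition Hfun (R : realType) (p : nat) (beta h : R) (x : R) : R :=
  beta * x ^+ p + h * x - rate_I x.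

(* Local maximality is relative to the domain [-1, 1] of the function, so the
   endpoints are not excluded a priori. *)
Definition local_maximizer (R : realType) (f : R -> R) (m : R) : Prop :=
  -1 <= m <= 1 /\ \forall y \near m, -1 <= y <= 1 -> f y <= f m.

(* The derivative of [Hfun] is considered on ]-1, 1[ only: elsewhere [f^`()]
   would be a default value or depend on how [ln] extends to x <= 0. *)
Definition stationary_point (R : realType) (f : R -> R) (x : R) : Prop :=
  -1 < x < 1 /\ f^`() x = 0.

Definition regular_set (R : realType) (p : nat) : set (R * R)%type :=
  [set bh | Theta R bh /\
    exists m : R,
      [/\ -1 < m < 1,
          local_maximizer (Hfun p bh.1 bh.2) m,
          (Hfun p bh.1 bh.2)^`(2) m < 0 &
          forall x : R, stationary_point (Hfun p bh.1 bh.2) x -> x = m]].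
Arguments regular_set : clear implicits.

Definition critical_set (R : realType) (p : nat) : set (R * R)%type :=
  [set bh | Theta R bh /\
    exists m1 m2 : R,
      [/\ m1 <> m2,
          local_maximizer (Hfun p bh.1 bh.2) m1 &
          local_maximizer (Hfun p bh.1 bh.2) m2]].
Arguments critical_set : clear implicits.

(* Main.v *)
Require Import Defs.
From mathcomp Require Import all_boot all_order all_algebra.
From mathcomp Require Import all_classical all_reals all_analysis.
From mathcomp Require Import ring lra.
Import Order.TTheory GRing.Theory Num.Theory.
Import numFieldNormedType.Exports.

Local Open Scope ring_scope.
Local Open Scope classical_set_scope.

(** Write H for [Hfun p beta h]. On ]-1, 1[ its derivative is
    [beta p x^(p-1) + h - artanh x], which tends to +oo at -1 and to -oo
    at 1; its second derivative is [beta p (p-1) x^(p-2) - 1/(1 - x^2)], which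
    does not involve h. Whenever H' passes from positive to negative on an
    interval, H has a local maximizer inside ([local_max_of_sign_change]).

    Points outside the closure of the critical set are regular. Suppose that
    some stationary point s has H''(s) >= 0. Then s^(p-2) > 0, so that raising
    beta by eps makes H''(s) positive, while lowering h by eps p s^(p-1) keeps
    s stationary. The new function has a strict local minimum at s, hence a
    local maximizer on each side of s, because of the signs of H' near -1 and
    1. As eps is arbitrarily small, (beta, h) is in the closure of the
    critical set ([closure_critical_of_ddH_ge0]). Off that closure,
    therefore, every stationary point is nondegenerate with H'' < 0, and two
    of them would give two local maximizers
    ([two_max_of_two_nondegenerate]); at least one exists by the signs at the
    ends.

    Regular points are not in the closure ([regular_not_closure]). Let m be
    the only stationary point. Near m, H'' is bounded away from 0, and away
    from m, |H'| is bounded below: by compactness in the middle, by the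
    infinite limits near the ends. Changing the parameters alters H' and H''
    by amounts that are small uniformly on ]-1, 1[, since the logarithmic part
    does not depend on them. So for nearby parameters all stationary points
    lie close to m, where H'' < 0, and by Rolle there is at most one. Local
    maximizers are stationary because the endpoints are never local maximizers
    ([local_max_interior]): the slope of the entropy is infinite there. *)

(** * Derivatives *)

Section CurieWeiss.
Context {R : realType}.
Implicit Types (p : nat) (beta h x : R).

Definition dH p (beta h x : R) : R :=
  beta * p%:R * x ^+ p.-1 + h - (ln (1 + x) - ln (1 - x)) / 2.

Definition ddH p (beta x : R) : R :=
  beta * (p%:R * p.-1%:R) * x ^+ p.-2 - (1 - x ^+ 2)^-1.

Lemma is_derive_ln1D x : -1 < x < 1 ->
  is_derive x 1 (fun y : R => ln (1 + y)) (1 + x)^-1.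
Proof.
move=> /andP[x1 x2]; rewrite -[_^-1]mulr1; apply: (@is_derive1_comp R (@ln R) (fun y => 1 + y)).
  by apply: is_derive1_ln; lra.
have -> : +%R (1 : R) = cst 1 + id by apply/funext.
by apply: is_derive_eq; ring.
Qed.

Lemma is_derive_ln1B x : -1 < x < 1 ->
  is_derive x 1 (fun y : R => ln (1 - y)) (- (1 - x)^-1).
Proof.
move=> /andP[x1 x2]; rewrite -mulrN1; apply: (@is_derive1_comp R (@ln R) (fun y => 1 - y)).
  by apply: is_derive1_ln; lra.
have -> : (fun y : R => 1 - y) = cst 1 - id by apply/funext.
by apply: is_derive_eq; ring.
Qed.

Lemma is_derive_Hfun p beta h x : -1 < x < 1 ->
  is_derive x 1 (Hfun p beta h) (dH p beta h x).
Proof.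
move=> x1; have l1 := is_derive_ln1D x x1; have l2 := is_derive_ln1B x x1.
have d1 : is_derive x 1 (cst 1 + id : R -> R) 1.
  by apply: is_derive_eq; rewrite add0r.
have d2 : is_derive x 1 (cst 1 - id : R -> R) (-1).
  by apply: is_derive_eq; rewrite sub0r.
have dI := is_deriveM (is_derive_cst (2^-1 : R) x 1)
  (is_deriveD (is_deriveM d1 l1) (is_deriveM d2 l2)).
have dP := is_deriveD (is_deriveM (is_derive_cst beta x 1)
  (is_deriveX p (is_derive_id x 1))) (is_deriveM (is_derive_cst h x 1) (is_derive_id x 1)).
have -> : Hfun p beta h = cst beta * id ^+ p + cst h * id - cst 2^-1 *
   ((cst 1 + id) * (fun y => ln (1 + y)) + (cst 1 - id) * (fun y => ln (1 - y))).
  by apply/funext => y; rewrite /Hfun /rate_I !fctE.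
apply: (@is_derive_eq _ _ _ _ _ _ _ _ (is_deriveB dP dI)).
rewrite /dH /GRing.scale /= !fctE; field; lra.
Qed.

Lemma is_derive_dH p beta h x : -1 < x < 1 ->
  is_derive x 1 (dH p beta h) (ddH p beta x).
Proof.
move=> x1; have l1 := is_derive_ln1D x x1; have l2 := is_derive_ln1B x x1.
have -> : dH p beta h = cst (beta * p%:R) * id ^+ p.-1 + cst h -
   ((fun y => ln (1 + y)) - (fun y => ln (1 - y))) * cst 2^-1.
  by apply/funext => y; rewrite /dH !fctE.
apply: is_derive_eq; rewrite /ddH /GRing.scale /= !fctE; field.
by apply/and3P; split; nra.
Qed.

Lemma derive1_Hfun p beta h x : -1 < x < 1 ->
  (Hfun p beta h)^`() x = dH p beta h x.
Proof. by move=> /(is_derive_Hfun p beta h) dx; rewrite derive1E derive_val. Qed.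

Lemma derive2_Hfun p beta h x : -1 < x < 1 ->
  (Hfun p beta h)^`(2) x = ddH p beta x.
Proof.
move=> x1; rewrite /= derive1E.
have dx := is_derive_dH p beta h x x1.
rewrite -(@derive_val _ _ _ _ _ _ _ dx); apply: near_eq_derive.
have : \forall y \near x, y \in `]-1, 1[%R by apply: near_in_itvoo; rewrite in_itv.
by apply: filterS => y; rewrite in_itv => /derive1_Hfun ->.
Qed.

(** * Local maximizers and sign changes *)

Lemma sign_near_root (f : R -> R) x l e : is_derive x 1 f l -> 0 < l ->
  f x = 0 -> 0 < e -> exists d, [/\ 0 < d, d < e, f (x - d) < 0 & 0 < f (x + d)].
Proof.
move=> [df vf] l0 fx e0.
have := df; rewrite /derivable => /cvg_ex[l' cl].
have El : l' = l by rewrite -vf /derive; apply/esym/cvg_lim.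
rewrite {}El in cl.
have : \forall t \near 0^', 0 < t^-1 *: ((f \o shift x) (t *: 1) - f x).
  exact: cvgr_gt cl _ l0.
rewrite /dnbhs near_withinE => /nbhs_ballP[r /= r0 rP].
pose d := Num.min (r / 2) (e / 2).
have d0 : 0 < d by rewrite /d lt_min; apply/andP; split; lra.
have dr : d < r by rewrite /d gt_min; apply/orP; left; lra.
have de : d < e by rewrite /d gt_min; apply/orP; right; lra.
have q y : y != 0 -> `|y| < r -> 0 < y^-1 * f (x + y).
  move=> y0 yr; have := rP y.
  rewrite /ball /= sub0r normrN => /(_ yr y0).
  by rewrite fx subr0 /GRing.scale /= mulr1 addrC.
exists d; split => //.
  have := q (- d); rewrite oppr_eq0 normrN gtr0_norm// => /(_ (lt0r_neq0 d0) dr).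
  by rewrite invrN mulNr oppr_gt0 pmulr_rlt0// invr_gt0.
have := q d; rewrite gtr0_norm// => /(_ (lt0r_neq0 d0) dr).
by rewrite pmulr_rgt0// invr_gt0.
Qed.

Lemma sign_near_root_neg (f : R -> R) x l e : is_derive x 1 f l -> l < 0 ->
  f x = 0 -> 0 < e -> exists d, [/\ 0 < d, d < e, 0 < f (x - d) & f (x + d) < 0].
Proof.
move=> df l0 fx e0.
have [||d [d0 de d1 d2]] := @sign_near_root (fun y => - f y) x (- l) e _ _ _ e0.
- by rewrite oppr_gt0.
- by rewrite fx oppr0.
by exists d; split => //; rewrite ?oppr_lt0 ?oppr_gt0 in d1 d2 *.
Qed.

(** A maximizer over [a, b] exists by compactness; the signs of the derivative
    at a and b push it into the interior, where it is a local maximizer.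
    Working on a compact subinterval of ]-1, 1[ avoids the endpoints, at which
    the logarithms are singular. *)
Lemma local_max_of_sign_change p beta h a b : -1 < a -> a < b -> b < 1 ->
  0 < dH p beta h a -> dH p beta h b < 0 ->
  exists2 m, a < m < b & local_maximizer (Hfun p beta h) m.
Proof.
move=> a1 ab b1 da db.
set f := Hfun p beta h.
have cf : {within `[a, b], continuous f}.
  apply: derivable_within_continuous => x; rewrite in_itv/= => /andP[x1 x2].
  by have [] // := is_derive_Hfun p beta h x _; lra.
have [c cab cM] := EVT_max (ltW ab) cf.
(* where H' <> 0, moving slightly in the direction of its sign increases H *)
have uphill x : -1 < x < 1 -> dH p beta h x != 0 -> forall e, 0 < e ->
    exists d, [/\ 0 < d, d < e & f x < f (x + Num.sg (dH p beta h x) * d)].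
  move=> x1 dx e e0.
  set s := dH p beta h x in dx *.
  have dg : is_derive x 1 (fun y => f y - f x) s.
    have := is_derive_Hfun p beta h x x1 => ?.
    by apply: is_derive_eq; rewrite subr0.
  have [sl|sg|s0] := ltgtP s 0; last by rewrite s0 eqxx in dx.
  - have [|d [d0 de d1 d2]] := sign_near_root_neg _ _ _ _ dg sl _ e0.
      by rewrite subrr.
    by exists d; split => //; rewrite ltr0_sg // mulN1r -subr_gt0.
  - have [|d [d0 de d1 d2]] := sign_near_root _ _ _ _ dg sg _ e0.
      by rewrite subrr.
    by exists d; split => //; rewrite gtr0_sg // mul1r -subr_gt0.
have ba : 0 < b - a by rewrite subr_gt0.
have ca : c != a.
  apply/eqP => E; subst c.
  have [||d [d0 de]] := uphill a _ _ _ ba; [lra|lra|].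
  rewrite gtr0_sg // mul1r ltNge cM //= in_itv /=; lra.
have cb : c != b.
  apply/eqP => E; subst c.
  have [||d [d0 de]] := uphill b _ _ _ ba; [lra|lra|].
  rewrite ltr0_sg // mulN1r ltNge cM //= in_itv /=; lra.
have cI : a < c < b.
  by move: cab; rewrite in_itv /= !le_eqVlt eq_sym (negPf ca) (negPf cb).
exists c => //; split; first lra.
have : \forall y \near c, y \in `]a, b[%R by apply: near_in_itvoo; rewrite in_itv.
apply: filterS => y; rewrite in_itv /= => ? _; apply: cM; rewrite in_itv/=; lra.
Qed.

Lemma local_max_stationary p beta h x : -1 < x < 1 ->
  local_maximizer (Hfun p beta h) x -> dH p beta h x = 0.
Proof.
move=> x1 [_ /nbhs_ballP[r /= r0 rP]].
set f := Hfun p beta h.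
have dx := is_derive_Hfun p beta h x x1.
pose e := Num.min r (Num.min (x + 1) (1 - x)).
have er : e <= r by rewrite /e ge_min lexx.
have e1 : e <= x + 1 by rewrite /e !ge_min lexx !orbT.
have e2 : e <= 1 - x by rewrite /e !ge_min lexx !orbT.
have e0 : 0 < e by rewrite /e !lt_min; lra.
have key y : x - e < y < x + e -> f y <= f x.
  move=> ye; apply: rP; rewrite /ball /=; last lra.
  by rewrite ltr_distlC; lra.
have [] := @derive1_at_max R f (x - e) (x + e) x.
- lra.
- move=> t; rewrite in_itv /= => te.
  by have [] // := is_derive_Hfun p beta h t _; lra.
- rewrite in_itv /=; lra.
- by move=> t; rewrite in_itv /=; apply: key.
by move=> _ <-; rewrite derive_val.
Qed.

(** * Behaviour at the endpoints *)

(** Transfers statements at 1 to -1; for odd p the sign of beta changes, so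
    the lemmas on the endpoints allow any real beta. *)
Lemma Hfun_opp p beta h x : Hfun p beta h (- x) = Hfun p ((-1) ^+ p * beta) (- h) x.
Proof. by rewrite /Hfun /rate_I [(- x) ^+ p]exprNn opprK; set s := (-1) ^+ p; set u := ln _; set v := ln _; ring. Qed.

Lemma ln_le_of_le_expR (M t : R) : 0 < t -> t <= expR (- M) -> ln t <= - M.
Proof. by move=> t0 tM; rewrite -[leRHS]expRK ler_ln// posrE ?expR_gt0. Qed.

Lemma norm_poly_le p beta h x : -1 <= x <= 1 ->
  `|beta * p%:R * x ^+ p.-1 + h| <= `|beta| * p%:R + `|h|.
Proof.
move=> x1; apply: le_trans (ler_normD _ _) _; rewrite lerD2r.
rewrite !normrM normrX normr_nat ler_piMr ?mulr_ge0//.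
by rewrite exprn_ile1 // ler_norml; lra.
Qed.

(** H' is a bounded polynomial minus artanh, which is infinite at both ends.
    The width [expR (- 2 A)] makes half of the singular logarithm at most - A,
    where A is the bound on the polynomial plus M; the other logarithm has the
    favourable sign because its argument is at least 1. *)
Lemma dH_ends p beta h M : 0 < M -> exists e, [/\ 0 < e, e < 1,
  forall x, 1 - e <= x < 1 -> dH p beta h x <= - M &
  forall x, -1 < x <= -1 + e -> M <= dH p beta h x].
Proof.
move=> M0; set A := `|beta| * p%:R + `|h| + M.
have A0 : 0 < A by rewrite /A ltr_wpDl // addr_ge0 ?mulr_ge0.
exists (expR (- (2 * A))); have e0 : 0 < expR (- (2 * A)) by apply: expR_gt0.
have e1 : expR (- (2 * A)) < 1 by rewrite expR_lt1; lra.
split => // x xe.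
- have := norm_poly_le p beta h x; rewrite ler_norml.
  move=> /(_ _)/andP[|_ H]; first lra.
  have H1 : 0 <= ln (1 + x) by apply: ln_ge0; lra.
  have := ln_le_of_le_expR (2 * A) (1 - x) _ _ => /(_ _ _)H2.
  by have {}H2 := H2 ltac:(lra) ltac:(lra); rewrite /dH; rewrite /A in H2 *; lra.
- have := norm_poly_le p beta h x; rewrite ler_norml.
  move=> /(_ _)/andP[|H _]; first lra.
  have H1 : 0 <= ln (1 - x) by apply: ln_ge0; lra.
  have := ln_le_of_le_expR (2 * A) (1 + x) _ _ => /(_ _ _)H2.
  by have {}H2 := H2 ltac:(lra) ltac:(lra); rewrite /dH; rewrite /A in H2 *; lra.
Qed.

Lemma bernoulli_le p (t : R) : 0 <= t <= 1 -> `|1 - (1 - t) ^+ p| <= p%:R * t.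
Proof.
move=> t01; elim: p => [|p IH]; first by rewrite expr0 subrr normr0 mul0r.
have -> : 1 - (1 - t) ^+ p.+1 = (1 - t) * (1 - (1 - t) ^+ p) + t by rewrite exprS; ring.
apply: le_trans (ler_normD _ _) _.
rewrite normrM -natr1 mulrDl mul1r lerD //; last by rewrite ger0_norm //; lra.
rewrite (le_trans _ IH) // ler_piMl // ger0_norm; lra.
Qed.

(** Moving from 1 to 1 - t gains at least -(t ln t) / 2 from the entropy and
    loses at most a constant times t from the polynomial, by Bernoulli's
    inequality. Once ln t < -2 A the gain dominates. *)
Lemma not_local_max_1 p beta h : ~ local_maximizer (Hfun p beta h) 1.
Proof.
move=> [_ /nbhs_ballP[r /= r0 rP]].
set A := `|beta| * p%:R + `|h| + 1.
have A0 : 0 < A by rewrite /A ltr_wpDl // addr_ge0 ?mulr_ge0.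
have e0 : 0 < expR (- (2 * A)) by apply: expR_gt0.
have e1 : expR (- (2 * A)) < 1 by rewrite expR_lt1; lra.
pose t := Num.min (r / 2) (expR (- (2 * A))).
have t0 : 0 < t by rewrite /t lt_min; lra.
have tr : t <= r / 2 by rewrite /t ge_min lexx.
have te : t <= expR (- (2 * A)) by rewrite /t ge_min lexx orbT.
have : Hfun p beta h (1 - t) <= Hfun p beta h 1.
  apply: rP; last lra.
  by rewrite /ball /= subKr gtr0_norm //; lra.
have Lt := ln_le_of_le_expR _ _ t0 te.
have H1 : ln (1 + (1 - t)) <= ln 2 by rewrite ler_ln ?posrE; lra.
have L2 : 0 <= ln 2 :> R by apply: ln_ge0; lra.
have := bernoulli_le p t ltac:(lra).
set P := 1 - _ => HP.
have HB : `|beta * P| <= `|beta| * p%:R * t.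
  by rewrite normrM -mulrA ler_wpM2l.
have {}HB : beta * P <= `|beta| * p%:R * t by apply: le_trans (ler_norm _) HB.
have Hh : h * t <= `|h| * t by rewrite ler_wpM2r ?ler_norm// ltW.
apply/negP; rewrite -ltNge /Hfun /rate_I subKr subrr mul0r addr0 expr1n mulr1.
have -> : beta * (1 - t) ^+ p = beta - beta * P by rewrite /P; ring.
rewrite /A in Lt.
have -> : 1 + 1 = 2 :> R by ring.
move: H1 Lt; set a := ln (1 + _); set b := ln t; set c := ln 2 in L2 * => H1 Lt.
have m1 : (2 - t) * a <= (2 - t) * c by rewrite ler_wpM2l //; lra.
have m2 : t * b <= t * - (2 * (`|beta| * p%:R + `|h| + 1)) by rewrite ler_wpM2l //; lra.
have m3 : 0 <= t * c by rewrite mulr_ge0 //; lra.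
have -> : 1 + (1 - t) = 2 - t by ring.
have -> : h * (1 - t) = h - h * t by ring.
have m4 : t * - (2 * (`|beta| * p%:R + `|h| + 1)) =
  - 2 * (`|beta| * p%:R * t) - 2 * (`|h| * t) - 2 * t by ring.
have m5 : (2 - t) * c = 2 * c - t * c by ring.
rewrite m5 in m1; rewrite m4 in m2; move: m1 m2 m3 HB Hh; clear -t0.
move: (t * c) (t * b) ((2 - t) * a) (beta * P) (h * t) (`|h| * t) (`|beta| * _ * t).
by move=> ? ? ? ? ? ? ?; lra.
Qed.

Lemma local_max_interior p beta h x :
  local_maximizer (Hfun p beta h) x -> -1 < x < 1.
Proof.
move=> Mx; have [x1 xn] := Mx.
have /andP[xa xb] := x1.
apply/andP; split; rewrite lt_neqAle ?xa ?xb andbT; apply/eqP => E.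
- apply: (@not_local_max_1 p ((-1) ^+ p * beta) (- h)); split; first lra.
  move: xn; rewrite -E => /nbhs_ballP[r /= r0 rP].
  apply/nbhs_ballP; exists r => //= y yr y1.
  rewrite -!Hfun_opp; apply: rP; last lra.
  by move: yr; rewrite /ball /= opprK -normrN opprB addrC.
- by apply: (@not_local_max_1 p beta h); rewrite -E.
Qed.

(** * Uniform bounds around a regular point *)

Lemma ddH_neg_near p beta m : -1 < m < 1 -> ddH p beta m < 0 ->
  exists d c, [/\ 0 < d, 0 < c &
    forall x, -1 < x < 1 -> `|x - m| < d -> ddH p beta x < - c].
Proof.
move=> m1 dm.
have cd : ddH p beta y @[y --> m] --> ddH p beta m.
  apply: cvgB; first by apply: cvgM; [exact: cvg_cst|exact: exprn_continuous].
  apply: cvgV; first nra.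
  by apply: cvgB; [exact: cvg_cst|exact: exprn_continuous].
have : \forall y \near m, ddH p beta y < ddH p beta m / 2.
  by apply: cvgr_lt cd _ _; lra.
move=> /nbhs_ballP[d /= d0 dP]; exists d, (- (ddH p beta m / 2)).
by split => // [|x _ xm]; [lra|rewrite opprK; apply: dP; rewrite /ball /= distrC].
Qed.

Lemma dH_bound_cc p beta h a b : -1 < a -> b < 1 ->
  (forall x, a <= x <= b -> dH p beta h x != 0) ->
  exists2 c, 0 < c & forall x, a <= x <= b -> c <= `|dH p beta h x|.
Proof.
move=> a1 b1 nz.
have [ab|ba] := leP a b; last first.
  by exists 1 => // x /andP[ax xb]; have := le_trans ax xb; rewrite leNgt ba.
have cf : {within `[a, b], continuous (fun x => `|dH p beta h x|)}.
  have cg : {within `[a, b], continuous (dH p beta h)}.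
    apply: derivable_within_continuous => x; rewrite in_itv/= => /andP[x1 x2].
    by have [] // := is_derive_dH p beta h x _; lra.
  by move=> x; apply: cvg_norm; exact: cg.
have [c cab cm] := EVT_min ab cf.
exists `|dH p beta h c|; first by rewrite normr_gt0 nz.
by move=> x xab; apply: cm; rewrite in_itv.
Qed.

(** The interval ]-1, 1[ minus the d-neighbourhood of m is covered by two end
    zones, where [dH_ends] gives |H'| >= 1, and two compact intervals, possibly
    empty, on which H' does not vanish. *)
Lemma dH_bound_away p beta h m d : 0 < d ->
  (forall x, -1 < x < 1 -> dH p beta h x = 0 -> x = m) ->
  exists2 c, 0 < c & forall x, -1 < x < 1 -> d <= `|x - m| -> c <= `|dH p beta h x|.
Proof.
move=> d0 um.
have [e [e0 e1 er el]] := dH_ends p beta h 1 ltr01.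
have [|||c1 c10 c1P] := @dH_bound_cc p beta h (- 1 + e) (Num.min (m - d) (1 - e)).
- lra.
- by rewrite gt_min; apply/orP; right; lra.
- move=> x; rewrite le_min => xe; apply/eqP => /um xm.
  by have {}xm := xm ltac:(lra); lra.
have [|||c2 c20 c2P] := @dH_bound_cc p beta h (Num.max (m + d) (- 1 + e)) (1 - e).
- by rewrite lt_max; apply/orP; right; lra.
- lra.
- move=> x; rewrite ge_max => xe; apply/eqP => /um xm.
  by have {}xm := xm ltac:(lra); lra.
exists (Num.min 1 (Num.min c1 c2)); first by rewrite !lt_min ltr01 c10.
move=> x x1 xm; rewrite !ge_min.
have [xl|xl] := leP x (- 1 + e).
  apply/orP; left; apply: le_trans (ler_norm _); apply: el; lra.
have [xr|xr] := leP (1 - e) x.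
  apply/orP; left; rewrite -normrN; apply: le_trans (ler_norm _).
  by rewrite lerNr; apply: er; lra.
apply/orP; right; apply/orP; move: xm; rewrite ler_normr => /orP[xm|xm].
  right; apply: c2P; rewrite ge_max; lra.
left; apply: c1P; rewrite le_min; lra.
Qed.

(** The singular part of H' does not depend on the parameters, hence these
    bounds are uniform on the whole open interval. *)
Lemma dH_perturb p beta h beta' h' x : -1 < x < 1 ->
  `|dH p beta' h' x - dH p beta h x| <= `|beta' - beta| * p%:R + `|h' - h|.
Proof.
move=> x1; apply: le_trans (norm_poly_le p (beta' - beta) (h' - h) x _); last lra.
by rewrite le_eqVlt; apply/orP; left; apply/eqP; congr `|_|; rewrite /dH; ring.
Qed.

Lemma ddH_perturb p beta beta' x : -1 < x < 1 ->
  `|ddH p beta' x - ddH p beta x| <= `|beta' - beta| * (p%:R * p.-1%:R).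
Proof.
move=> x1.
have -> : ddH p beta' x - ddH p beta x =
    (beta' - beta) * (p%:R * p.-1%:R) * x ^+ p.-2 by rewrite /ddH; ring.
rewrite !normrM !normr_nat normrX ler_piMr ?mulr_ge0//.
by rewrite exprn_ile1 // ler_norml; lra.
Qed.

(** * Creating two local maximizers *)

Lemma dH_ends_signs p beta h a b : -1 < a -> b < 1 -> exists a' b',
  [/\ -1 < a' < a, b < b' < 1, 0 < dH p beta h a' & dH p beta h b' < 0].
Proof.
move=> a1 b1; have [e [e0 e1 er el]] := dH_ends p beta h 1 ltr01.
pose d1 := Num.min e ((a + 1) / 2); pose d2 := Num.min e ((1 - b) / 2).
have d10 : 0 < d1 by rewrite /d1 lt_min; lra.
have d20 : 0 < d2 by rewrite /d2 lt_min; lra.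
have d1e : d1 <= e by rewrite /d1 ge_min lexx.
have d2e : d2 <= e by rewrite /d2 ge_min lexx.
have d1a : d1 <= (a + 1) / 2 by rewrite /d1 ge_min lexx orbT.
have d2b : d2 <= (1 - b) / 2 by rewrite /d2 ge_min lexx orbT.
exists (- 1 + d1), (1 - d2).
have := el (- 1 + d1) ltac:(lra); have := er (1 - d2) ltac:(lra).
by split; lra.
Qed.

(** H' is negative just left of s and positive just right of it; together with
    its signs at the ends this makes two changes from positive to
    negative. *)
Lemma two_max_of_local_min p beta h s : -1 < s < 1 ->
  dH p beta h s = 0 -> 0 < ddH p beta s -> exists m1 m2,
  [/\ m1 <> m2, local_maximizer (Hfun p beta h) m1 &
      local_maximizer (Hfun p beta h) m2].
Proof.
move=> s1 ds dds.
have e0 : 0 < Num.min (s + 1) (1 - s) by rewrite lt_min; lra.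
have [d [d0]] := sign_near_root _ _ _ _ (is_derive_dH p beta h s s1) dds ds e0.
rewrite lt_min => /andP[dl dr] sl sr.
have [a [b [al br ap bn]]] := dH_ends_signs p beta h (s - d) (s + d) ltac:(lra) ltac:(lra).
have [|||||m1 m1I M1] := @local_max_of_sign_change p beta h a (s - d); [lra|lra|lra|by[]|by[]|].
have [|||||m2 m2I M2] := @local_max_of_sign_change p beta h (s + d) b; [lra|lra|lra|by[]|by[]|].
by exists m1, m2; split => // E; subst; lra.
Qed.

(** H' changes from positive to negative in disjoint neighbourhoods of s
    and t. *)
Lemma two_max_of_two_nondegenerate p beta h s t : -1 < s -> s < t -> t < 1 ->
  dH p beta h s = 0 -> ddH p beta s < 0 ->
  dH p beta h t = 0 -> ddH p beta t < 0 -> exists m1 m2,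
  [/\ m1 <> m2, local_maximizer (Hfun p beta h) m1 &
      local_maximizer (Hfun p beta h) m2].
Proof.
move=> s1 st t1 ds dds dt ddt.
have s11 : -1 < s < 1 by lra.
have t11 : -1 < t < 1 by lra.
pose e := Num.min (Num.min (s + 1) (1 - t)) ((t - s) / 2).
have e0 : 0 < e by rewrite /e !lt_min; lra.
have e1 : e <= s + 1 by rewrite /e !ge_min lexx.
have e2 : e <= 1 - t by rewrite /e !ge_min lexx orbT.
have e3 : e <= (t - s) / 2 by rewrite /e !ge_min lexx orbT.
have [c [c0 ce cl cr]] := sign_near_root_neg _ _ _ _ (is_derive_dH p beta h s s11) dds ds e0.
have [d [d0 de dl dr]] := sign_near_root_neg _ _ _ _ (is_derive_dH p beta h t t11) ddt dt e0.
have [|||||m1 m1I M1] := @local_max_of_sign_change p beta h (s - c) (s + c); [lra|lra|lra|by[]|by[]|].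
have [|||||m2 m2I M2] := @local_max_of_sign_change p beta h (t - d) (t + d); [lra|lra|lra|by[]|by[]|].
by exists m1, m2; split => // E; subst; lra.
Qed.

(** * The closure of the critical set *)

Lemma closure_ball_prod (A : set (R * R)%type) (b h : R) :
  closure A (b, h) <-> forall e, 0 < e ->
    exists b' h', [/\ A (b', h'), `|b' - b| < e & `|h' - h| < e].
Proof.
split => [cA e e0|cA B /nbhs_ballP[e /= e0 eB]].
  have [[b' h'] [AB []]] := cA _ (nbhsx_ballx (b, h) e e0).
  by rewrite /ball /= => ? ?; exists b', h'; rewrite distrC [`|h' - h|]distrC.
have [b' [h' [AB bb hh]]] := cA e e0.
by exists (b', h'); split => //; apply: eB; split; rewrite /ball /= distrC.
Qed.

(** Replacing (beta, h) by (beta + eps, h - eps p s^(p-1)) keeps s stationary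
    and adds eps p (p-1) s^(p-2) to H''(s). The latter is positive: H''(s) >= 0
    forces beta p (p-1) s^(p-2) >= 1/(1 - s^2) > 0. Hence s becomes a strict
    local minimum. *)
Lemma closure_critical_of_ddH_ge0 p beta h s : (2 <= p)%N -> 0 < beta -> -1 < s < 1 ->
  dH p beta h s = 0 -> 0 <= ddH p beta s -> closure (critical_set R p) (beta, h).
Proof.
move=> p2 b0 s1 ds dds; apply/closure_ball_prod => e e0.
have p0 : 0 < p%:R :> R by rewrite ltr0n; apply: leq_trans p2.
have q0 : 0 < p.-1%:R :> R by rewrite ltr0n; case: p p2 {ds dds p0} => [|[]].
have sp : 0 < s ^+ p.-2.
  have := lt_le_trans (_ : 0 < (1 - s ^+ 2)^-1) (_ : _ <= beta * (p%:R * p.-1%:R) * s ^+ p.-2).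
  rewrite pmulr_rgt0 ?mulr_gt0//; apply; first by rewrite invr_gt0; nra.
  by rewrite -subr_ge0.
pose eps := e / (2 * p%:R).
have eps0 : 0 < eps by rewrite divr_gt0 // mulr_gt0.
have epse : eps * p%:R = e / 2 by rewrite /eps; field; lra.
exists (beta + eps), (h - eps * p%:R * s ^+ p.-1); split.
- split; first by rewrite /Theta /=; lra.
  apply: (@two_max_of_local_min _ _ _ s) => //=.
    by rewrite -ds /dH; ring.
  have -> : ddH p (beta + eps) s =
      ddH p beta s + eps * (p%:R * p.-1%:R) * s ^+ p.-2 by rewrite /ddH; ring.
  by apply: ltr_wpDl => //; do !apply: mulr_gt0 => //.
- rewrite addrC addKr gtr0_norm // (le_lt_trans (_ : _ <= eps * p%:R)) //; last lra.
  by rewrite ler_peMr ?ltW// ltr1n.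
- rewrite addrC addKr normrN epse normrM normrX ger0_norm; last lra.
  have : `|s| ^+ p.-1 <= 1 by rewrite exprn_ile1 // ler_norml; lra.
  have := exprn_ge0 p.-1 (normr_ge0 s); nra.
Qed.

(** With parameters closer than r to (beta, h), H' moves by at most r (p + 1)
    and H'' by at most r p (p-1); the constant K bounds both factors, so that
    r = min(c1, c2) / K keeps H' nonzero away from m, where |H'| >= c2, and H''
    negative near m, where H'' < - c1. *)
Lemma regular_not_closure p beta h m : -1 < m < 1 -> ddH p beta m < 0 ->
  (forall x, -1 < x < 1 -> dH p beta h x = 0 -> x = m) ->
  ~ closure (critical_set R p) (beta, h).
Proof.
move=> m1 dm um /closure_ball_prod cl.
have [d [c1 [d0 c10 c1P]]] := ddH_neg_near p beta m m1 dm.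
have [c2 c20 c2P] := dH_bound_away p beta h m d d0 um.
pose K : R := p%:R * p.-1%:R + p%:R + 1.
have pq : 0 <= p%:R * p.-1%:R :> R by rewrite mulr_ge0.
have p0 : 0 <= p%:R :> R by [].
have K0 : 0 < K by rewrite /K; lra.
pose c := Num.min c1 c2.
have c0 : 0 < c by rewrite /c lt_min c10.
have cc1 : c <= c1 by rewrite /c ge_min lexx.
have cc2 : c <= c2 by rewrite /c ge_min lexx orbT.
have [b' [h' [[_ [x1 [x2 /= [x12 M1 M2]]]] bb hh]]] := cl (c / K) (divr_gt0 c0 K0).
have rK : c / K * K = c by rewrite divfK // gt_eqF.
set r := c / K in bb hh rK.
have r0 : 0 < r by rewrite divr_gt0.
have P1 x : -1 < x < 1 -> `|dH p b' h' x - dH p beta h x| < c2.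
  move=> xI; apply: le_lt_trans (dH_perturb p beta h b' h' x xI) _.
  rewrite /K in rK; have := normr_ge0 (b' - beta); nra.
have P2 x : -1 < x < 1 -> `|ddH p b' x - ddH p beta x| < c1.
  move=> xI; apply: le_lt_trans (ddH_perturb p beta b' x xI) _.
  rewrite /K in rK; have := normr_ge0 (b' - beta); nra.
have near_m x : local_maximizer (Hfun p b' h') x -> [/\ -1 < x < 1, `|x - m| < d & dH p b' h' x = 0].
  move=> Mx; have xI := local_max_interior p b' h' x Mx.
  have dx := local_max_stationary p b' h' x xI Mx; split => //.
  rewrite ltNge; apply/negP => /(c2P x xI); rewrite leNgt => /negP; apply.
  by have := P1 x xI; rewrite dx sub0r normrN.
(* two zeros of H' near m would give a zero of H'' near m by Rolle *)
clear cl; wlog lt12 : x1 x2 x12 M1 M2 / x1 < x2.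
  move=> W; have [lt|gt|//] := ltgtP x1 x2; first exact: (W x1 x2).
  by apply: (W x2 x1) => // E; apply: x12.
have [I1 n1 z1] := near_m _ M1; have [I2 n2 z2] := near_m _ M2.
have [x|||y yI [_]] := @Rolle R (dH p b' h') x1 x2 lt12.
- by rewrite in_itv /= => xI; have [] // := is_derive_dH p b' h' x _; lra.
- apply: derivable_within_continuous => x; rewrite in_itv/= => xI.
  by have [] // := is_derive_dH p b' h' x _; lra.
- by rewrite z1 z2.
move: yI; rewrite in_itv /= => yI.
have yI1 : -1 < y < 1 by lra.
have dy := is_derive_dH p b' h' y yI1; rewrite derive_val => ddy.
have := P2 y yI1; rewrite ddy sub0r normrN ltr_norml => /andP[H _].
have := c1P y yI1; rewrite ltr_norml => H2.
move: n1 n2; rewrite !ltr_norml => n1 n2.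
by have := H2 ltac:(lra); lra.
Qed.
End CurieWeiss.

Theorem lemmaA2 (R : realType) (p : nat) (hp : (3 <= p)%N) :
  regular_set R p = Theta R `\` closure (critical_set R p).
Proof.
apply/seteqP; split => [[beta h] [b0 /= [m [m1 Mm ddm um]]]|[beta h] [b0 ncl]].
  split => //; apply: (@regular_not_closure R p beta h m) => //.
    by rewrite -(derive2_Hfun p beta h m m1).
  by move=> x x1 dx; apply: um; split => //; rewrite derive1_Hfun.
split => //.
have neg s : -1 < s < 1 -> dH p beta h s = 0 -> ddH p beta s < 0.
  move=> s1 ds; rewrite ltNge; apply/negP => dds; apply: ncl.
  by apply: (@closure_critical_of_ddH_ge0 R p beta h s) => //; apply: leq_trans hp.
have nC : ~ (exists m1 m2, [/\ m1 <> m2, local_maximizer (Hfun p beta h) m1 &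
      local_maximizer (Hfun p beta h) m2]).
  by move=> C; apply: ncl; apply: subset_closure.
have [a [b [aI bI da db]]] := @dH_ends_signs R p beta h 0 0 ltac:(lra) ltac:(lra).
have [|||||m mI Mm] := @local_max_of_sign_change R p beta h a b; [lra|lra|lra|by[]|by[]|].
have m1 : -1 < m < 1 by lra.
have dm := @local_max_stationary R p beta h m m1 Mm.
exists m; split => //; first by have := derive2_Hfun p beta h m m1; rewrite /= => ->; exact: neg.
move=> x [x1]; rewrite derive1_Hfun // => dx.
have ddm := neg _ m1 dm; have ddx := neg _ x1 dx.
have [xm|mx|//] := ltgtP x m; exfalso; apply: nC.
  by apply: (@two_max_of_two_nondegenerate R p beta h x m) => //; lra.
by apply: (@two_max_of_two_nondegenerate R p beta h m x) => //; lra.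
Qed.
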